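(* Let $L\ge1$ and let $\boldsymbol x=(x^1,\dots,x^L)$, $\boldsymbol y=(y^1,\dots,y^L)$ with all $x^i,y^i\in U$. Suppose $\ell(x^i)=\ell(y^i)$ for $1\le i\le L$, $\ell(x^i)\ne\ell(x^j)$ for $i\ne j$, and $$M(x^1,z)\cdots M(x^L,z)=M(y^1,z)\cdots M(y^L,z)$$ identically in the spectral parameter $z$. Then $x^i=y^i$ for all $1\le i\le L$.
   Context: Let $n\ge 4$. $U$ is the set of real tuples $x=(x_1,\dots,x_n,\bar x_{n-1},\dots,\bar x_1)\in\mathbb R^{2n-1}$ with all coordinates nonzero and $x_i+\bar x_i\ne0$ for $2\le i\le n-1$. The level is $\ell(x)=x_1\cdots x_n\bar x_{n-1}\cdots\bar x_1$. $\delta_{ij}$ is the Kronecker delta; empty products are $1$. **The $2n\times 2n$ matrix $M(x,z)$.** Write $M_{i,j}=M(x,z)_{i,j}$, $\ell=\ell(x)$, $\bar X_i=1+\bar x_i/x_i$. First column: $M_{1,1}=x_1/\bar x_1$; $M_{i,1}=x_1\cdots x_{i-1}(1+x_i/\bar x_i)$ for $2\le i\le n-1$; $M_{n,1}=x_1\cdots x_n$; $M_{n+1,1}=x_1\cdots x_{n-1}$; $M_{i,1}=\ell/(\bar x_1\cdots\bar x_{2n-i})$ for $n+2\le i\le 2n$. Other columns ($1\le i\le 2n$): $M_{i,j+1}=\frac{M_{i,j}}{x_j}+(\ell z-1)\big(\frac{\delta_{i,j}}{\bar x_j}+\delta_{i,j+1}\big)$ for $1\le j\le n-2$; $M_{i,n}=\frac{M_{i,n-1}}{x_{n-1}}+(\ell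 z-1)\big(\frac{\delta_{i,n-1}}{\bar x_{n-1}}+\delta_{i,n+1}\big)$; $M_{i,n+1}=\frac{M_{i,n-1}}{x_{n-1}x_n}+(\ell z-1)\big(\frac{\delta_{i,n-1}}{\bar x_{n-1}x_n}+\delta_{i,n}\big)$; $M_{i,2n}=z\frac{\bar x_1}{x_1}M_{i,1}+\delta_{i,2n}\frac{\bar x_1}{x_1}(1-\ell z)+\delta_{i,1}z(\ell z-1)$; $M_{i,2n-1}=z\bar x_1\bar X_2M_{i,1}+(1-\ell z)\big(\delta_{i,2n}\bar x_1\bar X_2+\delta_{i,2n-1}\frac{\bar x_2}{x_2}\big)$; $M_{i,2n-j}=\bar x_j\frac{\bar X_{j+1}}{\bar X_j}M_{i,2n+1-j}+(1-\ell z)\big(\delta_{i,2n+1-j}\bar x_j\frac{\bar X_{j+1}}{\bar X_j}+\delta_{i,2n-j}\frac{\bar x_{j+1}}{x_{j+1}}\big)$ for $2\le j\le n-2$. *)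

(* Defs.v *)
From mathcomp Require Import all_boot all_order all_algebra.
From mathcomp Require Import reals.
Set Implicit Arguments.
Unset Strict Implicit.
Unset Printing Implicit Defensive.
Import Order.TTheory GRing.Theory Num.Theory.
Local Open Scope ring_scope.

(* A point (x_1, ..., x_n, xbar_{n-1}, ..., xbar_1) is a tuple of length
   2n - 1; [xc] and [xbar] read it with the 1-based index k of the mathematics,
   meaningful for 1 <= k <= n and 1 <= k <= n - 1 respectively. *)
Section Point.
Variables (R : realType) (n : nat) (x : (2 * n - 1).-tuple R).

Definition xc (k : nat) : R := x`_(k - 1).
Definition xbar (k : nat) : R := x`_(2 * n - 1 - k).

Definition inU : Prop :=
  (forall c, c \in x -> c != 0) /\
  (forall i : nat, (2 <= i <= n - 1)%N -> xc i + xbar i != 0).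

Definition level : R :=
  (\prod_(1 <= i < n.+1) xc i) * (\prod_(1 <= i < n) xbar i).

Definition Xbar (i : nat) : R := 1 + xbar i / xc i.

Definition delta (i j : nat) : R := (i == j)%:R.

(* In everything below, row and column numbers are 1-based naturals. *)
Definition Mcol1 (i : nat) : R :=
  if i == 1%N then xc 1 / xbar 1
  else if (i <= n - 1)%N then
    (\prod_(1 <= k < i) xc k) * (1 + xc i / xbar i)
  else if i == n then \prod_(1 <= k < n.+1) xc k
  else if i == n.+1 then \prod_(1 <= k < n) xc k
  else level / \prod_(1 <= k < (2 * n - i).+1) xbar k.

Variable z : R.

(* [Mleft j i] is the entry in row i of column j + 1, for 0 <= j <= n - 2. *)
Fixpoint Mleft (j i : nat) : R :=
  match j with
  | 0%N => Mcol1 i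
  | j'.+1 => Mleft j' i / xc j
             + (level * z - 1) * (delta i j / xbar j + delta i j.+1)
  end.

(* [Mright j i] is the entry in row i of column 2n - j, for 0 <= j <= n - 2. *)
Fixpoint Mright (j i : nat) : R :=
  match j with
  | 0%N => z * (xbar 1 / xc 1) * Mcol1 i
           + delta i (2 * n) * (xbar 1 / xc 1) * (1 - level * z)
           + delta i 1 * z * (level * z - 1)
  | 1%N => z * xbar 1 * Xbar 2 * Mcol1 i
           + (1 - level * z) * (delta i (2 * n) * xbar 1 * Xbar 2
                                + delta i (2 * n - 1) * (xbar 2 / xc 2))
  | j'.+1 => xbar j * (Xbar j.+1 / Xbar j) * Mright j' i
             + (1 - level * z)
               * (delta i (2 * n + 1 - j) * xbar j * (Xbar j.+1 / Xbar j)
                  + delta i (2 * n - j) * (xbar j.+1 / xc j.+1))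
  end.

Definition Mentry (i j : nat) : R :=
  if (j <= n - 1)%N then Mleft (j - 1) i
  else if j == n then
    Mleft (n - 2) i / xc (n - 1)
    + (level * z - 1) * (delta i (n - 1) / xbar (n - 1) + delta i n.+1)
  else if j == n.+1 then
    Mleft (n - 2) i / (xc (n - 1) * xc n)
    + (level * z - 1) * (delta i (n - 1) / (xbar (n - 1) * xc n) + delta i n)
  else Mright (2 * n - j) i.

Definition M : 'M[R]_(2 * n) := \matrix_(i, j) Mentry i.+1 j.+1.

End Point.

(* Main.v *)
Require Import Defs.
From mathcomp Require Import all_boot all_order all_algebra.
From mathcomp Require Import reals.
From mathcomp Require Import zify ring.
Set Implicit Arguments.
Unset Strict Implicit.
Unset Printing Implicit Defensive.
Import Order.TTheory GRing.Theory Num.Theory.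
Local Open Scope ring_scope.

(** Everything rests on two facts about the one-parameter family [M x z].
- If [level x * z = 1], every Kronecker delta in the recurrences for the
  columns comes with the factor [0], so each column is a multiple of the
  first one: [M x z] is the product of the column [Mcol1 x] and a row
  [row_factor x z] whose first entry is [1] ([M_singular]).  Ratios of
  consecutive entries of this row give back [x_1], ..., [x_n], and then
  [xbar_1], ..., [xbar_{n-1}] in this order, so the row determines [x]
  ([row_factor_inj]).
- If [level x * z != 1], then [M x z] is invertible ([M_unit]).  For a row
  vector [W] in the left kernel, the column recurrences, divided by
  [level x * z - 1], express all entries of [W] through [W 1]; the pairing of
  [W] with the first column telescopes to [level x * z - 1] times a nonzero
  multiple of [W 1], whence [W = 0].

For two equal products, take [z] to be the inverse of the level of the last
factor.  Distinctness of the levels makes all other factors on the [x] side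
invertible, so the common product has rank one and its row space is spanned by
the row factor of [x^L], and equally by that of [y^L]; hence [x^L = y^L]
([eq_of_singular_products]).  At the inverses of the remaining levels, the last
factor is invertible and cancels, so the argument repeats with one factor less.
The induction therefore only ever looks at the values
[z = (level (x k))^-1] ([prod_M_inj]). *)

(** * Nonvanishing *)

Lemma prod_nat_neq0 (R : idomainType) a b (F : nat -> R) :
  (forall k, (a <= k < b)%N -> F k != 0) -> \prod_(a <= k < b) F k != 0.
Proof.
move=> F0; rewrite prodf_seq_neq0; apply/allP => k.
by rewrite mem_index_iota; apply: F0.
Qed.

Section OnePoint.
Variables (R : realType) (n : nat) (x : (2 * n - 1).-tuple R).
Hypotheses (hn : (4 <= n)%N) (Ux : inU x).

Lemma xc_neq0 k : (1 <= k <= n)%N -> xc x k != 0.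
Proof.
by move=> hk; case: Ux => + _; apply; rewrite mem_nth // size_tuple; lia.
Qed.

Lemma xbar_neq0 k : (1 <= k <= n - 1)%N -> xbar x k != 0.
Proof.
by move=> hk; case: Ux => + _; apply; rewrite mem_nth // size_tuple; lia.
Qed.

Lemma Xbar_neq0 k : (2 <= k <= n - 1)%N -> Xbar x k != 0.
Proof.
move=> hk; have xk0 : xc x k != 0 by apply: xc_neq0; lia.
rewrite /Xbar -(divff xk0) -mulrDl mulf_neq0 ?invr_neq0 //.
by case: Ux => _; apply.
Qed.

Lemma prod_xc_neq0 m : (m <= n.+1)%N -> \prod_(1 <= k < m) xc x k != 0.
Proof.
by move=> hm; apply: prod_nat_neq0 => k hk; apply: xc_neq0; lia.
Qed.

Lemma prod_xbar_neq0 m : (m <= n)%N -> \prod_(1 <= k < m) xbar x k != 0.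
Proof.
by move=> hm; apply: prod_nat_neq0 => k hk; apply: xbar_neq0; lia.
Qed.

Lemma level_neq0 : level x != 0.
Proof. by rewrite mulf_neq0 ?prod_xc_neq0 ?prod_xbar_neq0. Qed.

Lemma Mcol1_1_neq0 : Mcol1 x 1 != 0.
Proof.
rewrite /Mcol1 /= mulf_neq0 ?invr_neq0 //; first by apply: xc_neq0; lia.
by apply: xbar_neq0; lia.
Qed.

(** * Rank one at the inverse of the level *)

(** The recursive case of [Mright] as a rewriting rule: simplification would
also unfold the inner occurrence of [Mright]. *)
Lemma MrightSS z j i : Mright x z j.+2 i =
  xbar x j.+2 * (Xbar x j.+3 / Xbar x j.+2) * Mright x z j.+1 i
  + (1 - level x * z)
    * (delta R i (2 * n + 1 - j.+2) * xbar x j.+2 * (Xbar x j.+3 / Xbar x j.+2)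
       + delta R i (2 * n - j.+2) * (xbar x j.+3 / xc x j.+3)).
Proof. by []. Qed.

Section Singular.
Variable z : R.
Hypothesis lz : level x * z = 1.

(** The entries in the last branch solve the recurrence of the right-hand
columns: the quotients [Xbar_{j+1} / Xbar_j] telescope. *)
Definition row_factor (j : nat) : R :=
  if (j <= n)%N then (\prod_(1 <= k < j) xc x k)^-1
  else if j == n.+1 then (\prod_(1 <= k < n.+1) xc x k)^-1
  else if j == (2 * n)%N then z * (xbar x 1 / xc x 1)
  else z * (\prod_(1 <= k < (2 * n - j).+1) xbar x k) * Xbar x (2 * n - j).+1.

Lemma Mleft_singular j i :
  Mleft x z j i = Mcol1 x i * (\prod_(1 <= k < j.+1) xc x k)^-1.
Proof.
elim: j => [|j IH] /=; first by rewrite big_geq // invr1 mulr1.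
by rewrite IH lz subrr mul0r addr0 [in RHS]big_nat_recr //= invfM mulrA.
Qed.

Lemma Mright_singular j i : (1 <= j <= n - 2)%N ->
  Mright x z j i =
    Mcol1 x i * (z * (\prod_(1 <= k < j.+1) xbar x k) * Xbar x j.+1).
Proof.
elim: j => [//|[|j] IH] hj.
  rewrite /= lz subrr mul0r addr0 big_nat1; ring.
rewrite MrightSS lz subrr mul0r addr0 IH; last by lia.
rewrite [in RHS]big_nat_recr //=.
have : Xbar x j.+2 != 0 by apply: Xbar_neq0; lia.
by move=> ?; field.
Qed.

Lemma Mentry_singular i j : (1 <= j <= 2 * n)%N ->
  Mentry x z i j = Mcol1 x i * row_factor j.
Proof.
move=> hj; rewrite /Mentry /row_factor.
have en : (n - 2).+1 = (n - 1)%N by lia.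
have prodn : \prod_(1 <= k < n) xc x k =
    (\prod_(1 <= k < n - 1) xc x k) * xc x (n - 1).
  have e : n = (n - 1).+1 by lia.
  by rewrite [X in \prod_(1 <= k < X) _]e big_nat_recr //=; lia.
case: ifP => [j_small|j_big].
  have -> : (j <= n)%N by lia.
  by rewrite Mleft_singular; have -> : (j - 1).+1 = j by lia.
case: eqP => [->|jn].
  by rewrite leqnn Mleft_singular en lz subrr mul0r addr0 prodn invfM mulrA.
have -> : (j <= n)%N = false by lia.
case: eqP => [_|jn1].
  rewrite Mleft_singular en lz subrr mul0r addr0.
  rewrite big_nat_recr ?prodn /=; last by lia.
  by rewrite !invfM !mulrA.
case: eqP => [->|j2n].
  by rewrite subnn /= lz !subrr !mulr0 !addr0 mulrC.
by rewrite Mright_singular; last by lia.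
Qed.

End Singular.

(** * Invertibility away from the inverse of the level *)

Section Kernel.
Variables (z : R) (W : nat -> R).
Hypothesis lz : level x * z != 1.

Definition dot (f : nat -> R) : R := \sum_(1 <= i < (2 * n).+1) W i * f i.

Hypothesis W_ker : forall j, (1 <= j <= 2 * n)%N ->
  dot (fun i => Mentry x z i j) = 0.

Lemma dot_delta k : (1 <= k <= 2 * n)%N -> dot (delta R ^~ k) = W k.
Proof.
move=> hk; rewrite /dot (bigD1_seq k) ?mem_index_iota ?iota_uniq //=.
rewrite /delta eqxx mulr1 big1 ?addr0 // => i /negbTE ->.
by rewrite mulr0.
Qed.

(** Each column of [M] but the first has the shape of [g] below, with [f] a
column defined before it, so this turns each column recurrence into a relation
between two entries of [W]. *)
Lemma dot_comb (g f : nat -> R) a b c k l :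
  (forall i, g i = a * f i + b * delta R i k + c * delta R i l) ->
  (1 <= k <= 2 * n)%N -> (1 <= l <= 2 * n)%N ->
  dot g = a * dot f + b * W k + c * W l.
Proof.
move=> gE hk hl; rewrite -(dot_delta hk) -(dot_delta hl) /dot !mulr_sumr.
by rewrite -!big_split; apply: eq_bigr => i _ /=; rewrite gE; ring.
Qed.

Lemma dot_Mleft j : (j <= n - 2)%N -> dot (Mleft x z j) = 0.
Proof.
move=> hj; rewrite -(W_ker (j := j.+1)); last by lia.
apply: eq_bigr => i _; rewrite /Mentry ifT; last by lia.
by have -> : (j.+1 - 1 = j)%N by lia.
Qed.

Lemma dot_Mright j : (j <= n - 2)%N -> dot (Mright x z j) = 0.
Proof.
move=> hj; rewrite -(W_ker (j := (2 * n - j)%N)); last by lia.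
apply: eq_bigr => i _; rewrite /Mentry !ifF; try by lia.
by rewrite subKn //; lia.
Qed.

Let c0 : level x * z - 1 != 0. Proof. by rewrite subr_eq0. Qed.

Lemma ker_left j : (1 <= j <= n - 2)%N -> W j / xbar x j + W j.+1 = 0.
Proof.
case: j => // j hj; apply: (mulfI c0); rewrite mulr0.
have := dot_Mleft (j := j.+1); rewrite (dot_comb
  (f := Mleft x z j) (a := (xc x j.+1)^-1)
  (b := (level x * z - 1) / xbar x j.+1)
  (c := level x * z - 1) (k := j.+1) (l := j.+2)); try by lia.
  rewrite dot_Mleft; last by lia.
  by move=> <-; last lia; ring.
by move=> i /=; ring.
Qed.

Lemma ker_n1 : W (n - 1) / xbar x (n - 1) + W n.+1 = 0.
Proof.
apply: (mulfI c0); rewrite mulr0.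
have := W_ker (j := n); rewrite (dot_comb
  (f := Mleft x z (n - 2)) (a := (xc x (n - 1))^-1)
  (b := (level x * z - 1) / xbar x (n - 1))
  (c := level x * z - 1) (k := (n - 1)%N) (l := n.+1)); try by lia.
  rewrite dot_Mleft; last by lia.
  by move=> <-; last lia; ring.
move=> i; rewrite /Mentry ifF; last by lia.
by rewrite eqxx; ring.
Qed.

Lemma ker_n : W (n - 1) / (xbar x (n - 1) * xc x n) + W n = 0.
Proof.
apply: (mulfI c0); rewrite mulr0.
have := W_ker (j := n.+1); rewrite (dot_comb
  (f := Mleft x z (n - 2)) (a := (xc x (n - 1) * xc x n)^-1)
  (b := (level x * z - 1) / (xbar x (n - 1) * xc x n))
  (c := level x * z - 1) (k := (n - 1)%N) (l := n)); try by lia.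
  rewrite dot_Mleft; last by lia.
  by move=> <-; last lia; ring.
move=> i; rewrite /Mentry; do 2 (rewrite ifF; last by lia).
by rewrite eqxx; ring.
Qed.

Lemma ker_2n : W (2 * n) = z * (xc x 1 / xbar x 1) * W 1.
Proof.
have x1 : xc x 1 != 0 by apply: xc_neq0; lia.
have xb1 : xbar x 1 != 0 by apply: xbar_neq0; lia.
have : dot (Mright x z 0) = 0 by apply: dot_Mright.
rewrite (dot_comb
  (f := Mleft x z 0) (a := z * (xbar x 1 / xc x 1))
  (b := (1 - level x * z) * (xbar x 1 / xc x 1))
  (c := z * (level x * z - 1)) (k := (2 * n)%N) (l := 1%N)); try by lia.
  rewrite dot_Mleft // => e; apply: (mulfI c0).
  apply: (mulfI (x := xbar x 1 / xc x 1)).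
    by rewrite mulf_neq0 ?invr_neq0.
  apply/eqP; rewrite -subr_eq0 -oppr_eq0 -e; apply/eqP; field.
  by rewrite x1 xb1.
by move=> i /=; ring.
Qed.

Lemma ker_2n1 :
  W (2 * n) * xbar x 1 * Xbar x 2 + W (2 * n - 1) * (xbar x 2 / xc x 2) = 0.
Proof.
apply: (mulfI c0); rewrite mulr0.
have : dot (Mright x z 1) = 0 by apply: dot_Mright; lia.
rewrite (dot_comb
  (f := Mleft x z 0) (a := z * xbar x 1 * Xbar x 2)
  (b := (1 - level x * z) * (xbar x 1 * Xbar x 2))
  (c := (1 - level x * z) * (xbar x 2 / xc x 2))
  (k := (2 * n)%N) (l := (2 * n - 1)%N)); try by lia.
  rewrite dot_Mleft // => e; apply/eqP; rewrite -oppr_eq0 -e; apply/eqP; ring.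
by move=> i /=; ring.
Qed.

Lemma ker_right j : (2 <= j <= n - 2)%N ->
  W (2 * n + 1 - j) * xbar x j * (Xbar x j.+1 / Xbar x j)
    + W (2 * n - j) * (xbar x j.+1 / xc x j.+1) = 0.
Proof.
case: j => [//|[//|j]] hj; apply: (mulfI c0); rewrite mulr0.
have : dot (Mright x z j.+2) = 0 by apply: dot_Mright; lia.
rewrite (dot_comb
  (f := Mright x z j.+1) (a := xbar x j.+2 * (Xbar x j.+3 / Xbar x j.+2))
  (b := (1 - level x * z) * (xbar x j.+2 * (Xbar x j.+3 / Xbar x j.+2)))
  (c := (1 - level x * z) * (xbar x j.+3 / xc x j.+3))
  (k := (2 * n + 1 - j.+2)%N) (l := (2 * n - j.+2)%N)); try by lia.
  rewrite dot_Mright; last by lia.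
  by move=> e; apply/eqP; rewrite -oppr_eq0 -e; apply/eqP; ring.
by move=> i; rewrite MrightSS; ring.
Qed.

(** Up to sign, the product of the ratios [x_k / xbar_k]; the sign makes
[alt_ratio 1] equal to [x_1 / xbar_1]. *)
Definition alt_ratio (m : nat) : R :=
  - \prod_(1 <= k < m.+1) (- (xc x k / xbar x k)).

Lemma alt_ratioS m : (1 <= m)%N ->
  alt_ratio m.+1 = - alt_ratio m * (xc x m.+1 / xbar x m.+1).
Proof. by move=> hm; rewrite /alt_ratio big_nat_recr //=; ring. Qed.

Lemma Mcol1_mid m : (2 <= m <= n - 1)%N ->
  Mcol1 x m = (\prod_(1 <= k < m) xc x k) * (1 + xc x m / xbar x m).
Proof. by move=> hm; rewrite /Mcol1 ifF ?ifT //; lia. Qed.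

Lemma Mcol1_bottom m : (1 <= m <= n - 1)%N ->
  Mcol1 x (2 * n + 1 - m) = level x / \prod_(1 <= k < m) xbar x k.
Proof.
move=> hm; rewrite /Mcol1 !ifF; try by lia.
by have -> : (2 * n - (2 * n + 1 - m)).+1 = m by lia.
Qed.

(** By [ker_left] the summands are [r_1], [- (r_1 + r_2)], [r_2 + r_3], ... up
to the factor [W 1], where [r_m] is the product of the [x_k / xbar_k] for
[k <= m], so the partial sums telescope.  The second equation expresses [W m]
through [W 1] and is what the induction needs to advance. *)
Lemma top_sum m : (1 <= m <= n - 1)%N ->
  \sum_(1 <= i < m.+1) W i * Mcol1 x i = alt_ratio m * W 1 /\
  W m * (\prod_(1 <= k < m.+1) xc x k) / xbar x m = alt_ratio m * W 1.
Proof.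
elim: m => [//|[_ _|m IH hm]].
  rewrite /alt_ratio !big_nat1 /Mcol1 /=; split; ring.
have [IH1 IH2] : _ /\ _ := IH ltac:(lia).
have Wm : W m.+2 = - (W m.+1 / xbar x m.+1).
  by apply/eqP; rewrite -addr_eq0 addrC ker_left //; lia.
have e : W m.+2 * \prod_(1 <= k < m.+2) xc x k = - (alt_ratio m.+1 * W 1).
  by rewrite -IH2 Wm; ring.
split.
  rewrite big_nat_recr //= IH1 Mcol1_mid; last by lia.
  rewrite mulrA e (alt_ratioS (m := m.+1)) //; ring.
rewrite big_nat_recr //= mulrA e (alt_ratioS (m := m.+1)) //; ring.
Qed.

(** The last [m] rows, read upwards, repeat the pattern of [top_sum] with an
extra factor [level x * z], which [ker_2n] introduces.  The factor [Xbar x m] in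
the second equation is the ratio of the summand [r_{m-1} + r_m] to [r_m]; the
first summand is [r_1] alone, hence the exception at [m = 1]. *)
Lemma bottom_sum m : (1 <= m <= n - 1)%N ->
  \sum_(1 <= i < m.+1) W (2 * n + 1 - i) * Mcol1 x (2 * n + 1 - i)
    = level x * z * (alt_ratio m * W 1) /\
  W (2 * n + 1 - m) * level x / \prod_(1 <= k < m) xbar x k
    = level x * z * (alt_ratio m * W 1) * (if m == 1%N then 1 else Xbar x m).
Proof.
elim: m => [//|[_ hm|m IH hm]].
  rewrite !big_nat1 Mcol1_bottom // big_geq // addnK ker_2n /alt_ratio big_nat1.
  split; rewrite /= ?invr1; ring.
have [IH1 IH2] : _ /\ _ := IH ltac:(lia).
have xm : xc x m.+2 != 0 by apply: xc_neq0; lia.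
have xbm : xbar x m.+2 != 0 by apply: xbar_neq0; lia.
have xbm1 : xbar x m.+1 != 0 by apply: xbar_neq0; lia.
have P0 : \prod_(1 <= k < m.+1) xbar x k != 0 by apply: prod_xbar_neq0; lia.
(* [ker_2n1] is [ker_right] at [j = 1] without the denominator [Xbar x 1]. *)
have step : W (2 * n + 1 - m.+2) = - (W (2 * n + 1 - m.+1) * xbar x m.+1
    * (if m.+1 == 1%N then 1 else (Xbar x m.+1)^-1) * Xbar x m.+2
    * (xc x m.+2 / xbar x m.+2)).
  have -> : (2 * n + 1 - m.+2 = 2 * n - m.+1)%N by lia.
  case: (m) hm xm xbm => [|m'] hm xm xbm.
    move: ker_2n1; rewrite /= addnK mulr1 => /eqP; rewrite addr_eq0 => /eqP ->.
    by field; rewrite xm xbm.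
  have Xm : Xbar x m'.+2 != 0 by apply: Xbar_neq0; lia.
  have /eqP := ker_right (j := m'.+2) ltac:(lia).
  rewrite addrC addr_eq0 /= => /eqP e.
  apply: (mulIf (x := xbar x m'.+3 / xc x m'.+3)).
    by rewrite mulf_neq0 ?invr_neq0.
  by rewrite e; field; rewrite xm xbm Xm.
have key : W (2 * n + 1 - m.+2) * level x / \prod_(1 <= k < m.+2) xbar x k
    = level x * z * (alt_ratio m.+2 * W 1) * Xbar x m.+2.
  have c1 : (if m.+1 == 1%N then 1 else Xbar x m.+1) != 0.
    by case: ifP => [_|?]; rewrite ?oner_neq0 ?Xbar_neq0 //; lia.
  have {IH2} IH2 : W (2 * n + 1 - m.+1) * level x
      * (if m.+1 == 1%N then 1 else (Xbar x m.+1)^-1)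
      / \prod_(1 <= k < m.+1) xbar x k = level x * z * (alt_ratio m.+1 * W 1).
    apply: (mulIf c1); rewrite -IH2.
    move: c1; case: ifP => _ c1; field; by rewrite ?P0 ?c1.
  rewrite (alt_ratioS (m := m.+1)) //.
  transitivity (- (level x * z * (alt_ratio m.+1 * W 1))
     * (xc x m.+2 / xbar x m.+2) * Xbar x m.+2); last by ring.
  rewrite -IH2 step big_nat_recr //=.
  by field; rewrite P0 xbm xbm1.
split; last by [].
rewrite big_nat_recr //= IH1 Mcol1_bottom // [W _ * (_ / _)]mulrA key.
rewrite (alt_ratioS (m := m.+1)) //.
by rewrite /Xbar; field; rewrite xm xbm.
Qed.

(** With [S = alt_ratio (n - 1) * W 1], the rows above [n] contribute [S], the
rows [n] and [n + 1] contribute [- S] each, and the rows below contribute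
[level x * z * S]. *)
Lemma dot_Mcol1 : dot (Mcol1 x) =
  (level x * z - 1) * (alt_ratio (n - 1) * W 1).
Proof.
have hm : (1 <= n - 1 <= n - 1)%N by lia.
have [t1 t2] := top_sum hm; have [b1 _] := bottom_sum hm.
have en : (n - 1).+1 = n by lia.
rewrite en in t1 t2 b1.
have xn : xc x n != 0 by apply: xc_neq0; lia.
have xb : xbar x (n - 1) != 0 by apply: xbar_neq0; lia.
rewrite /dot (big_cat_nat (n := n)) //=; try by lia.
rewrite t1 [X in _ + X]big_ltn; last by lia.
rewrite [X in _ + (_ + X)]big_ltn; last by lia.
have -> : \sum_(n.+2 <= i < (2 * n).+1) W i * Mcol1 x i
    = level x * z * (alt_ratio (n - 1) * W 1).
  rewrite -b1 [RHS]big_nat_rev /= -[n.+2]/(1 + n.+1)%N.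
  have -> : ((2 * n).+1 = n + n.+1)%N by lia.
  rewrite big_addn; have -> : (n + n.+1 - n.+1 = n)%N by lia.
  apply: eq_big_nat => i hi.
  by have -> : (2 * n + 1 - (1 + n - i.+1) = i + n.+1)%N by lia.
have -> : Mcol1 x n = (\prod_(1 <= k < n) xc x k) * xc x n.
  rewrite /Mcol1; do 2 (rewrite ifF; last by lia).
  by rewrite eqxx big_nat_recr //=; lia.
have -> : Mcol1 x n.+1 = \prod_(1 <= k < n) xc x k.
  rewrite /Mcol1; do 3 (rewrite ifF; last by lia).
  by rewrite eqxx.
rewrite -(addr0_eq ker_n) -(addr0_eq ker_n1).
by rewrite -t2; field; rewrite xn xb.
Qed.

Lemma ker_W1 : W 1 = 0.
Proof.
have d0 : dot (Mcol1 x) = 0 by have := dot_Mleft (leq0n (n - 2)).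
have /eqP := dot_Mcol1; rewrite d0 eq_sym !mulf_eq0 (negbTE c0) /=.
have -> /= : (alt_ratio (n - 1) == 0) = false.
  apply/negbTE; rewrite oppr_eq0; apply: prod_nat_neq0 => k hk.
  rewrite oppr_eq0 mulf_neq0 ?invr_neq0 //.
    by apply: xc_neq0; lia.
  by apply: xbar_neq0; lia.
by move/eqP.
Qed.

Lemma ker_trivial k : (1 <= k <= 2 * n)%N -> W k = 0.
Proof.
have top m : (1 <= m <= n - 1)%N -> W m = 0.
  elim: m => [//|[_ _|m IH hm]]; first exact: ker_W1.
  have := ker_left (j := m.+1) ltac:(lia); rewrite IH; last by lia.
  by rewrite mul0r add0r.
have bottom m : (1 <= m <= n - 1)%N -> W (2 * n + 1 - m) = 0.
  move=> hm; have [_ e] := bottom_sum hm.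
  have c : level x / \prod_(1 <= k < m) xbar x k != 0.
    by rewrite mulf_neq0 ?invr_neq0 ?level_neq0 ?prod_xbar_neq0 //; lia.
  by apply: (mulIf c); rewrite mulrA e ker_W1 !mulr0 !mul0r.
move=> hk; case: (leqP k (n - 1)) => h1; first by apply: top; lia.
case: (leqP n.+2 k) => h2.
  have -> : (k = 2 * n + 1 - (2 * n + 1 - k))%N by lia.
  by apply: bottom; lia.
have Wn1 : W (n - 1) = 0 by apply: top; lia.
have [->|->] : k = n \/ k = n.+1 by lia.
- by have := ker_n; rewrite Wn1 mul0r add0r.
- by have := ker_n1; rewrite Wn1 mul0r add0r.
Qed.

End Kernel.

(** The kernel computation is stated for sequences indexed from [1], so a row
vector is first extended by zero. *)
Lemma M_unit z : level x * z != 1 -> M x z \in unitmx.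
Proof.
move=> lz; rewrite -row_free_unit; apply: inj_row_free => w wM.
pose W k := if insub k.-1 is Some i then w ord0 i else 0 : R.
have WE (i : 'I_(2 * n)) : W i.+1 = w ord0 i by rewrite /W /= valK.
apply/rowP => i; rewrite mxE -WE.
apply: (ker_trivial (z := z) (W := W)) => //; last by rewrite /= ltn_ord.
case=> [//|j] hj.
have := congr1 (fun A : 'rV_(2 * n) => A ord0 (Ordinal hj)) wM.
rewrite !mxE => <-; rewrite /dot big_add1 big_mkord.
by apply: eq_bigr => k _; rewrite WE mxE.
Qed.

Definition Mcol1_vec : 'cV[R]_(2 * n) := \col_i Mcol1 x i.+1.
Definition row_factor_vec z : 'rV[R]_(2 * n) := \row_j row_factor z j.+1.

Lemma M_singular z : level x * z = 1 -> M x z = Mcol1_vec *m row_factor_vec z.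
Proof.
move=> lz; apply/matrixP => i j.
by rewrite !mxE big_ord1 !mxE Mentry_singular //= ltn_ord.
Qed.

End OnePoint.

(** * Recovering the points from the product *)

Section TwoPoints.
Variables (R : realType) (n : nat).
Hypothesis hn : (4 <= n)%N.

Lemma eq_coordinates (x y : (2 * n - 1).-tuple R) :
  (forall k, (1 <= k <= n)%N -> xc x k = xc y k) ->
  (forall k, (1 <= k <= n - 1)%N -> xbar x k = xbar y k) -> x = y.
Proof.
move=> exc exbar; apply/val_inj/(@eq_from_nth _ 0).
  by rewrite !size_tuple.
rewrite size_tuple => i hi.
case: (ltnP i n) => h.
  have := exc i.+1; rewrite /xc; have -> : (i.+1 - 1 = i)%N by lia.
  by apply; lia.
have := exbar (2 * n - 1 - i)%N; rewrite /xbar.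
have -> : (2 * n - 1 - (2 * n - 1 - i) = i)%N by lia.
by apply; lia.
Qed.

(** The entries with index at most [n + 1] are the inverses of the partial
products of the [x_k]; the entry [2n] gives [xbar_1], and reading leftwards from
it, each entry brings in one new unknown [xbar_{j+1}], through [Xbar_{j+1}]. *)
Lemma row_factor_inj (x y : (2 * n - 1).-tuple R) (z : R) :
  inU x -> inU y -> z != 0 ->
  (forall j, (1 <= j <= 2 * n)%N -> row_factor x z j = row_factor y z j) ->
  x = y.
Proof.
move=> Ux Uy z0 rE.
have prodE m : (1 <= m <= n.+1)%N ->
    \prod_(1 <= k < m) xc x k = \prod_(1 <= k < m) xc y k.
  move=> hm; apply: invr_inj; have := rE m; rewrite /row_factor.
  case: (leqP m n) => h; first by apply; lia.
  have -> : m = n.+1 by lia.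
  by rewrite eqxx; apply; lia.
have exc k : (1 <= k <= n)%N -> xc x k = xc y k.
  move=> hk; have := prodE k.+1; rewrite !big_nat_recr /=; try by lia.
  rewrite prodE; last by lia.
  by move/(_ ltac:(lia)); apply: mulfI; apply: (prod_xc_neq0 hn Uy); lia.
apply: eq_coordinates => //.
suff pre m : (1 <= m <= n - 1)%N ->
    forall k, (1 <= k <= m)%N -> xbar x k = xbar y k.
  by move=> k hk; apply: (pre (n - 1)%N); lia.
elim: m => [//|[_ _ k hk|m IH hm k hk]].
  have -> : k = 1%N by lia.
  have := rE (2 * n)%N ltac:(lia); rewrite /row_factor.
  have -> : (2 * n <= n)%N = false by lia.
  have -> : (2 * n == n.+1)%N = false by lia.
  rewrite eqxx => /(mulfI z0); rewrite exc; last by lia.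
  by apply: mulIf; rewrite invr_neq0 //; apply: (xc_neq0 hn Uy); lia.
case: (leqP k m.+1) => hkm; first by apply: IH; lia.
have -> : k = m.+2 by lia.
have := rE (2 * n - m.+1)%N ltac:(lia); rewrite /row_factor !ifF; try by lia.
have -> : (2 * n - (2 * n - m.+1) = m.+1)%N by lia.
have -> : \prod_(1 <= k < m.+2) xbar x k = \prod_(1 <= k < m.+2) xbar y k.
  by apply: eq_big_nat => i hi; apply: IH; lia.
have P0 : z * \prod_(1 <= k < m.+2) xbar y k != 0.
  by rewrite mulf_neq0 //; apply: (prod_xbar_neq0 hn Uy); lia.
move/(mulfI P0) /addrI; rewrite exc; last by lia.
by apply: mulIf; rewrite invr_neq0 //; apply: (xc_neq0 hn Uy); lia.
Qed.

(** Both sides have rank one.  Since row factors start with [1], the first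
columns of the two products agree, and that column is nonzero because [A] is
invertible; in a row where it does not vanish, the entries of the two products
are the two row factors scaled by the same nonzero number. *)
Lemma eq_of_singular_products (x y : (2 * n - 1).-tuple R)
    (A B : 'M[R]_(2 * n)) z :
  inU x -> inU y -> level x * z = 1 -> level y * z = 1 -> A \in unitmx ->
  A *m M x z = B *m M y z -> x = y.
Proof.
move=> Ux Uy lx ly uA; rewrite !M_singular // !mulmxA.
set a := A *m _; set b := B *m _ => ab.
have pos : (0 < 2 * n)%N by lia.
have abE i (j : 'I_(2 * n)) :
    a i ord0 * row_factor x z j.+1 = b i ord0 * row_factor y z j.+1.
  move/matrixP/(_ i j): ab.
  rewrite [X in X = _ -> _]mxE [X in _ = X -> _]mxE !big_ord1.
  by rewrite ![row_factor_vec _ _ _ _]mxE.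
have first (t : (2 * n - 1).-tuple R) : row_factor t z 1 = 1.
  by rewrite /row_factor ifT; [rewrite big_geq // invr1 | lia].
have eab i : a i ord0 = b i ord0.
  by have := abE i (Ordinal pos); rewrite /= !first !mulr1.
have [i ai] : exists i, a i ord0 != 0.
  apply/existsP; apply: contraT => /existsPn a0.
  have a_eq0 : a = 0.
    apply/colP => i; rewrite [RHS]mxE; apply/eqP.
    by have := a0 i; rewrite negbK.
  have : Mcol1_vec x = 0 by rewrite -(mulKmx uA (Mcol1_vec x)) -/a a_eq0 mulmx0.
  move/colP/(_ (Ordinal pos)); rewrite !mxE /= => /eqP.
  by rewrite (negbTE (Mcol1_1_neq0 hn Ux)).
have z0 : z != 0.
  by apply: contra_eq_neq lx => ->; rewrite mulr0 eq_sym oner_neq0.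
apply: (row_factor_inj Ux Uy z0) => -[//|j] hj.
by apply: (mulfI ai); rewrite (abE i (Ordinal hj)) eab.
Qed.

(** Restricting the hypothesis to the inverses of the levels makes it
inherited by the shorter product: at the inverse of another level the last
factor is invertible, so it can be cancelled without a continuity or
polynomiality argument in [z]. *)
Lemma prod_M_inj L (x y : 'I_L -> (2 * n - 1).-tuple R) :
  (forall i, inU (x i)) -> (forall i, inU (y i)) ->
  (forall i, level (x i) = level (y i)) ->
  (forall i j : 'I_L, i != j -> level (x i) != level (x j)) ->
  (forall k : 'I_L, \prod_(i < L) M (x i) (level (x k))^-1
                  = \prod_(i < L) M (y i) (level (x k))^-1) ->
  forall i, x i = y i.
Proof.
elim: L x y => [x y _ _ _ _ _ []//|L IH x y Ux Uy lvl dist prodE].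
have lz i : level (x i) * (level (x i))^-1 = 1 by rewrite divff ?level_neq0.
have lzN i j : i != j -> level (x i) * (level (x j))^-1 != 1.
  move=> ij; apply: contra_neq (dist _ _ ij) => e.
  by apply: (mulIf (x := (level (x j))^-1)); rewrite ?invr_neq0 ?level_neq0 ?lz.
have emax : x ord_max = y ord_max.
  have := prodE ord_max; rewrite !big_ord_recr /=.
  apply: eq_of_singular_products => //; rewrite -?lvl ?lz //.
  apply: (big_ind (fun A => A \in unitmx)) => [|A B uA uB|i _].
  - exact: unitmx1.
  - by rewrite unitmx_mul uA.
  - apply: M_unit => //; apply: lzN.
    by rewrite -val_eqE /= neq_ltn ltn_ord.
have wneq (k : 'I_L) : ord_max != widen_ord (leqnSn L) k.
  by rewrite -val_eqE /= neq_ltn ltn_ord orbT.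
have IHx (i : 'I_L) : x (widen_ord (leqnSn L) i) = y (widen_ord (leqnSn L) i).
  move: i.
  apply: (IH (x \o widen_ord _) (y \o widen_ord _)) => //= [i j ij|k].
    by apply: dist; apply: contra_neq ij => /(congr1 val) /= e; apply: val_inj.
  have := prodE (widen_ord (leqnSn L) k); rewrite !big_ord_recr /= -emax.
  have uM : M (x ord_max) (level (x (widen_ord (leqnSn L) k)))^-1 \in unitmx.
    by apply: M_unit => //; apply: lzN.
  exact: (can_inj (mulmxK uM)).
move=> i; case: (unliftP ord_max i) => [j ->|-> //].
have -> : lift ord_max j = widen_ord (leqnSn L) j.
  by apply: val_inj; rewrite /= /bump leqNgt ltn_ord.
exact: IHx.
Qed.

End TwoPoints.

Theorem theorem3p13 (R : realType) (n : nat) (hn : (4 <= n)%N)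
  (L : nat) (hL : (1 <= L)%N)
  (x y : 'I_L -> (2 * n - 1).-tuple R)
  (hx : forall i, inU (x i)) (hy : forall i, inU (y i))
  (hlevel : forall i, level (x i) = level (y i))
  (hdistinct : forall i j : 'I_L, i != j -> level (x i) != level (x j))
  (hprod : forall z : R, \prod_(i < L) M (x i) z = \prod_(i < L) M (y i) z) :
  forall i, x i = y i.
Proof.
by apply: (prod_M_inj hn) => // k.
Qed.
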